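(* Let $(p_m)_{m\geq 1}$ be a sequence in $[0,1)$ with $p_m = o(1/m)$ as $m\to\infty$, and write $p=p_m$. Then $(T_{m,p}-T_{m,0})/m \to 0$ in probability as $m\to\infty$, and consequently $(T_{m,p} - m\log m)/m$ converges in law, as $m\to\infty$, to a standard Gumbel distribution.
   Context: For an integer $m\geq 1$, let $\{C_n\}_{n\geq 1}$ be uniformly distributed on $[m]=\{1,\dots,m\}$ and $\{U_n\}_{n\geq1}$ be uniformly distributed on $(0,1)$, with the whole family $\{U_n,C_n\}_{n\geq1}$ independent. For $i\in[m]$ and $n>0$ let $L(i,n)=\sup\{1\leq k\leq n : C_k=i\}$ (with $\sup\emptyset=-\infty$). For $p\in[0,1)$ the clumsy coupon collection time is $$T_{m,p}=\inf\{n>0 : L(i,n)>0 \text{ and } U_{L(i,n)}\leq 1-p \text{ for all } i\in[m]\}.$$ For fixed $m$, the variables $T_{m,p}$ for different $p$ (in particular $T_{m,0}$) are coupled by using the same $C_n$ and $U_n$. The standard Gumbel distribution has cumulative distribution function $F(x)=\exp(-e^{-x})$, $x\in\mathbb{R}$. *)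

(* Defs.v *)
From HB Require Import structures.
From mathcomp Require Import all_boot all_order all_algebra finmap.
From mathcomp Require Import all_classical all_reals all_analysis.
Set Implicit Arguments.
Unset Strict Implicit.
Unset Printing Implicit Defensive.
Import Order.TTheory GRing.Theory Num.Theory numFieldNormedType.Exports.

Local Open Scope classical_set_scope.
Local Open Scope ring_scope.

Definition mutually_independent (R : realType) (d : measure_display)
    (T : measurableType d) (P : probability T R) (I : choiceType) (D : set I)
    (F : I -> set (set T)) : Prop :=
  forall (J : {fset I}) (A : I -> set T),
    [set` J] `<=` D -> (forall j, j \in J -> F j (A j)) ->
    P (\bigcap_(j in [set` J]) A j) = (\prod_(j <- J) P (A j))%E.

(* The variables X m may live on different probability spaces. *)
Definition cvg_in_probability (R : realType) (d : nat -> measure_display)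
    (T : forall m, measurableType (d m)) (P : forall m, probability (T m) R)
    (X : forall m, T m -> \bar R) (c : R) : Prop :=
  forall e : R, 0 < e ->
    P m [set w | (e%:E < `|X m w - c%:E|)%E] @[m --> \oo] --> (0 : \bar R).

(* F is the cumulative distribution function of the limit law. *)
Definition cvg_in_law (R : realType) (d : nat -> measure_display)
    (T : forall m, measurableType (d m)) (P : forall m, probability (T m) R)
    (X : forall m, T m -> \bar R) (F : R -> R) : Prop :=
  forall x : R, {for x, continuous F} ->
    P m [set w | (X m w <= x%:E)%E] @[m --> \oo] --> (F x)%:E.

Definition gumbel_cdf (R : realType) (x : R) : R := expR (- expR (- x)).

Section ClumsyCoupons.
Context (R : realType) (d : measure_display) (T : measurableType d).
Implicit Types (P : probability T R) (m n i : nat) (p : R).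

(* The sequences are indexed from 1; the entries C 0 and U 0 play no role. *)
Definition coupon_sigma P (C : nat -> {RV P >-> nat}) (U : nat -> {RV P >-> R})
    (j : nat + nat) : set (set T) :=
  match j with
  | inl n => g_sigma_algebra_preimage (C n)
  | inr n => g_sigma_algebra_preimage (U n)
  end.

(* The laws are only compared on measurable sets: off them, a measure takes
   unspecified values. *)
Definition clumsy_coupons P m (C : nat -> {RV P >-> nat})
    (U : nat -> {RV P >-> R}) : Prop :=
  [/\ (forall n, (0 < n)%N -> forall i, (1 <= i <= m)%N ->
         P [set w | C n w = i] = (m%:R^-1)%:E),
      (forall n, (0 < n)%N -> forall A : set R, measurable A ->
         distribution P (U n) A = uniform_prob (@ltr01 R) A) &
      mutually_independent P
        [set j | match j with inl n | inr n => (0 < n)%N end]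
        (coupon_sigma C U)].

Definition last_draw (C : nat -> T -> nat) i n (w : T) : \bar R :=
  ereal_sup [set k%:R%:E | k in [set k | (1 <= k <= n)%N /\ C k w = i]].

(* When positive, L(i,n) is a natural number, which Num.truncn (fine _)
   recovers. *)
Definition clumsy_complete (C : nat -> T -> nat) (U : nat -> T -> R) m p n
    (w : T) : Prop :=
  forall i, (1 <= i <= m)%N ->
    (0 < last_draw C i n w)%E /\
    U (Num.truncn (fine (last_draw C i n w))) w <= 1 - p.

Definition clumsy_time (C : nat -> T -> nat) (U : nat -> T -> R) m p
    (w : T) : \bar R :=
  ereal_inf
    [set n%:R%:E | n in [set n | (0 < n)%N /\ clumsy_complete C U m p n w]].

End ClumsyCoupons.

(* Main.v *)
(* Let S be the first time at which every coupon has been drawn, a function of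
   the draws C alone.  Conditionally on the draws up to S, the last draws of the
   m coupons before S are m fixed indices, so by independence of U and C one of
   them is clumsy with probability at most m p; otherwise T_{m,p} = S.  With
   p = o(1/m), T_{m,p} and T_{m,0} thus both equal S outside an event of vanishing
   probability.  The law of S is a count of surjections: by inclusion-exclusion
   P(S <= n) = sum_j (-1)^j C(m,j) (1 - j/m)^n, and for n = m log m + m x the
   terms converge to (-e^{-x})^j / j! while being dominated by the terms of an
   exponential series, so that the sum converges to exp(-e^{-x}). *)
Require Import Defs.
From HB Require Import structures.
From mathcomp Require Import all_boot all_order all_algebra finmap.
From mathcomp Require Import all_classical all_reals all_analysis.
From mathcomp Require Import measurable_realfun ring lra.
Set Implicit Arguments.
Unset Strict Implicit.
Unset Printing Implicit Defensive.
Import Order.TTheory GRing.Theory Num.Theory numFieldNormedType.Exports.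

Local Open Scope classical_set_scope.
Local Open Scope ring_scope.

(** * Counting surjections by inclusion-exclusion *)

Section Combinatorics.
Variables (R : numFieldType) (m n : nat).

Definition surjectiveb (w : {ffun 'I_n -> 'I_m}) :=
  [forall i, [exists k, w k == i]].

(* Inclusion-exclusion: expand the product over i of 1 - [w misses i]. *)
Lemma card_surjections : #|surjectiveb|%:R =
  \sum_(j < m.+1) (-1) ^+ j * 'C(m, j)%:R * (m - j)%:R ^+ n :> R.
Proof.
pose miss (w : {ffun 'I_n -> 'I_m}) i : R := [forall k, w k != i]%:R.
have -> : #|surjectiveb|%:R = \sum_w \prod_i (1 - miss w i).
  rewrite -sum1_card natr_sum (big_mkcond (mem surjectiveb)) /=.
  apply: eq_bigr => w _; case: ifPn => [/forallP sw|].
    rewrite big1// => i _; rewrite /miss.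
    case: (boolP [forall k, w k != i]) => [/forallP nw|]; last by rewrite subr0.
    by have /existsP[k wk] := sw i; have := nw k; rewrite wk.
  rewrite negb_forall => /existsP[i]; rewrite negb_exists => nw.
  by rewrite (bigD1 i)//= /miss nw subrr mul0r.
(* Expanding the product selects the set [J] of factors that contribute [- miss w i]. The product of
   these indicators says that [w] avoids all of [J]. *)
have E w : \prod_i (1 - miss w i) =
    \sum_(J : {set 'I_m}) (-1) ^+ #|J| * [forall k, w k \notin J]%:R.
  under eq_bigr do rewrite addrC.
  rewrite bigA_distr; apply: eq_bigr => J _.
  rewrite -big_mkcond /= prodrN; congr (_ * _).
  have [/forallP nw|] := boolP [forall k, w k \notin J].
    rewrite big1// => i iJ; rewrite /miss.
    suff -> : [forall k, w k != i] by [].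
    by apply/forallP => k; apply/eqP => wk; have := nw k; rewrite wk iJ.
  rewrite negb_forall => /existsP[k]; rewrite negbK => wJ.
  rewrite (bigD1 (w k))//= /miss.
  suff /negbTE -> : ~~ [forall k0, w k0 != w k] by rewrite mul0r.
  by rewrite negb_forall; apply/existsP; exists k; rewrite negbK.
under eq_bigr do rewrite E.
rewrite exchange_big /=.
(* Words avoiding [J] are the functions into its complement, which has [m - #|J|] elements. *)
have C (J : {set 'I_m}) : \sum_(w : {ffun 'I_n -> 'I_m}) (-1) ^+ #|J| * [forall k, w k \notin J]%:R =
    (-1) ^+ #|J| * (m - #|J|)%:R ^+ n :> R.
  rewrite -mulr_sumr; congr (_ * _).
  transitivity (#|[pred w : {ffun 'I_n -> 'I_m} | w \in ffun_on (~: J)]|%:R : R).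
    rewrite -sum1_card natr_sum [RHS]big_mkcond /=; apply: eq_bigr => w _.
    rewrite !inE; case: ifPn => [/ffun_onP wJ|wJ].
      suff -> : [forall k, w k \notin J] by [].
      by apply/forallP => k; have := wJ k; rewrite inE.
    suff /negbTE -> : ~~ [forall k, w k \notin J] by [].
    by apply: contraNN wJ => /forallP nw; apply/ffun_onP => k; rewrite inE.
  have -> : (m - #|J|)%N = #|~: J|.
    by apply/esym/(canRL (addKn _)); rewrite cardsC card_ord.
  by rewrite card_ffun_on card_ord natrX.
under eq_bigr do rewrite C.
(* The summand depends on [J] only through its size, so subsets are grouped by cardinality; [inord]
   is faithful here because [#|J| <= m]. *)
rewrite (partition_big (fun J : {set 'I_m} => inord #|J| : 'I_m.+1) predT)//=.
apply: eq_bigr => j _.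
rewrite (eq_bigr (fun=> (-1) ^+ j * (m - j)%:R ^+ n)); last first.
  move=> J /eqP <-; rewrite inordK// ltnS.
  by rewrite (leq_trans (max_card _))// card_ord.
rewrite sumr_const.
rewrite -[LHS]mulr_natr mulrAC; congr (_ * _%:R * _).
rewrite -[X in 'C(X, _)]card_ord -card_draws -cardsE.
apply: eq_card => J; rewrite inE unfold_in /=.
have Jm : (#|J| < m.+1)%N by rewrite ltnS (leq_trans (max_card _))// card_ord.
transitivity (nat_of_ord (@inord m #|J|) == j :> nat); first by [].
by rewrite inordK// inE.
Qed.

End Combinatorics.

Arguments surjectiveb : clear implicits.

(** * Dominated convergence for sums of growing length *)

Section Tannery.
Variable R : realType.

(** Cut every sum at one index [K] beyond which the tail of [g] is small. Below [K] only finitely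
    many limits are involved; above [K] the domination by [g] makes the remainders small uniformly
    in [m]. *)
Lemma tannery (a : nat -> nat -> R) (b g : nat -> R) (N : nat -> nat) :
  (forall j, a m j @[m --> \oo] --> b j) ->
  (\forall m \near \oo, forall j, `|a m j| <= g j) ->
  cvgn (series g) -> (forall K, \forall m \near \oo, (K <= N m)%N) ->
  \sum_(j < N m) a m j @[m --> \oo] --> limn (series b).
Proof.
move=> ab ag cg NK.
have bg j : `|b j| <= g j.
  have abj : `|a m j| @[m --> \oo] --> `|b j| by apply: cvg_norm; exact: ab.
  apply: (@closed_cvg _ _ \oo _ _ (fun x => x <= g j) _ _ _ abj).
    exact: closed_le.
  by apply: filterS ag => m; exact.
have cb : cvgn (series b).
  apply: normed_cvg.
  by apply: (series_le_cvg _ _ bg) => // j; exact: le_trans (normr_ge0 _) (bg j).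
apply/cvgrPdist_lt => e e0.
have e4 : 0 < e / 4 by rewrite divr_gt0.
near \oo => K.
have gK : forall n, (K <= n)%N -> `|limn (series g) - series g n| < e / 4.
  near: K; move/cvgrPdist_lt : cg => /(_ _ e4)[M _ gM].
  by exists M => // k /= Mk n kn; apply: gM => /=; exact: leq_trans kn.
have bK : `|limn (series b) - series b K| < e / 4.
  by near: K; move/cvgrPdist_lt : cb; exact.
have abK : series (a m) K @[m --> \oo] --> series b K.
  rewrite /series /=; under eq_cvg do rewrite big_mkord.
  rewrite big_mkord; apply: cvg_big => [|j _]; first exact: add_continuous.
  exact: ab.
move/cvgrPdist_lt : abK => /(_ _ e4) abK.
near=> m.
have KN : (K <= N m)%N by near: m; exact: NK.
have amg j : `|a m j| <= g j by move: j; near: m.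
(* The tail is bounded by the difference of two partial sums of [g], each within [e / 4] of the
   limit. The other two quarters of [e] go to [bK] and [mid]. *)
have tail : `|series (a m) (N m) - series (a m) K| < e / 4 + e / 4.
  rewrite sub_series_geq//.
  apply: (@le_lt_trans _ _ (series g (N m) - series g K)).
    by rewrite sub_series_geq// (le_trans (ler_norm_sum _ _ _))// ler_sum.
  have := gK _ (leqnn K); have := gK _ KN.
  rewrite !ltr_norml => /andP[? ?] /andP[? ?]; lra.
have mid : `|series b K - series (a m) K| < e / 4 by near: m.
move: tail mid bK; rewrite {1}/series/= big_mkord !ltr_norml.
by move=> /andP[? ?] /andP[? ?] /andP[? ?]; lra.
Unshelve. all: by end_near. Qed.

End Tannery.

(** * Asymptotics of one inclusion-exclusion term *)

Section GumbelLimit.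
Variable R : realType.

Lemma expr_1B_le (y : R) n : y <= 1 -> (1 - y) ^+ n <= expR (- (n%:R * y)).
Proof.
move=> y1; rewrite -mulrN expRM_natl; apply: lerXn2r.
- by rewrite nnegrE subr_ge0.
- by rewrite nnegrE expR_ge0.
- exact: expR_ge1Dx.
Qed.

(** With z = y/(1-y) one has 1/(1-y) = 1 + z <= e^z; invert and raise to the power [n]. *)
Lemma expr_1B_ge (y : R) n : y < 1 ->
  expR (- (n%:R * (y / (1 - y)))) <= (1 - y) ^+ n.
Proof.
move=> y1; have y1' : 0 < 1 - y by rewrite subr_gt0.
rewrite -mulrN expRM_natl; apply: lerXn2r => /=.
- by rewrite nnegrE expR_ge0.
- by rewrite nnegrE ltW.
rewrite expRN -[X in _ <= X]invrK lef_pV2 ?posrE ?invr_gt0 ?expR_gt0//.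
rewrite (le_trans _ (expR_ge1Dx _))//.
by rewrite le_eqVlt; apply/orP; left; apply/eqP; field; rewrite gt_eqF.
Qed.

Lemma bin_le_expn_fact (m j : nat) : 'C(m, j)%:R <= m%:R ^+ j / j`!%:R :> R.
Proof.
rewrite ler_pdivlMr ?ltr0n ?fact_gt0// -natrM bin_ffact -natrX ler_nat.
elim: j => // j IH; rewrite ffactnSr expnSr leq_mul//; exact: leq_subr.
Qed.

Lemma cvg_invn : (m%:R^-1 : R) @[m --> \oo] --> (0 : R).
Proof.
apply/gtr0_cvgV0; last exact: cvgr_idn.
by near=> m; rewrite ltr0n; near: m; exact: nbhs_infty_gt.
Unshelve. all: by end_near. Qed.

(** Passing from [j] to [j.+1] multiplies the ratio by (m-j)/m = 1 - j/m, which tends to 1. *)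
Lemma cvg_ffact (j : nat) :
  ((m ^_ j)%:R / m%:R ^+ j : R) @[m --> \oo] --> (1 : R).
Proof.
elim: j => [|j IH].
  under eq_cvg do rewrite ffactn0 expr0 divr1; exact: cvg_cst.
have : ((m ^_ j)%:R / m%:R ^+ j * (1 - j%:R * m%:R^-1) : R) @[m --> \oo]
    --> (1 * (1 - j%:R * 0) : R).
  apply: cvgM => //; apply: cvgB; first exact: cvg_cst.
  apply: cvgM; [exact: cvg_cst|exact: cvg_invn].
rewrite mulr0 subr0 mulr1; apply: cvg_trans; apply: near_eq_cvg.
near=> m.
have jm : (j < m)%N by near: m; exact: nbhs_infty_gt.
have m0 : m%:R != 0 :> R by rewrite pnatr_eq0 -lt0n (leq_ltn_trans _ jm).
rewrite ffactnSr natrM natrB ?(ltnW jm)// exprSr; field.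
by rewrite m0 expf_neq0.
Unshelve. all: by end_near. Qed.

Lemma cvg_lnn_div : (ln m%:R * m%:R^-1 : R) @[m --> \oo] --> (0 : R).
Proof.
(* ln m = 2 ln (sqrt m) <= 2 sqrt m *)
have h : (2 * Num.sqrt (m%:R^-1) : R) @[m --> \oo] --> (2 * Num.sqrt 0 : R).
  apply: cvgM; first exact: cvg_cst.
  by apply: continuous_cvg; [exact: sqrt_continuous|exact: cvg_invn].
rewrite sqrtr0 mulr0 in h.
apply: (squeeze_cvgr _ (cvg_cst 0) h).
near=> m.
have m1 : (0 < m)%N by near: m; apply: nbhs_infty_gt.
have m0 : 0 < m%:R :> R by rewrite ltr0n.
rewrite divr_ge0 ?ln_ge0 ?ler1n// ?ler0n//=.
rewrite ler_pdivrMr// sqrtrV// -mulrA -[X in _ * (_ * X)](sqr_sqrtr (ltW m0)).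
rewrite expr2 mulKf ?gt_eqF ?sqrtr_gt0//.
rewrite -{1}(sqr_sqrtr (ltW m0)) lnXn ?sqrtr_gt0//.
have s0 : 0 < Num.sqrt m%:R :> R by rewrite sqrtr_gt0.
have : ln (1 + (Num.sqrt m%:R - 1)) <= Num.sqrt m%:R - 1 :> R.
  by apply: le_ln1Dx; lra.
rewrite subrKC; lra.
Unshelve. all: by end_near. Qed.

(** Write n(m) = m (ln m + c(m)) with c(m) -> x. The binomial coefficient grows like m^j / j!, and
    m^j = e^{j ln m} cancels the logarithmic part of (1 - j/m)^{n(m)}, which is close to e^{-j (ln m
    + c(m))}. *)
Lemma cvg_bin_gumbel (n : nat -> nat) (x : R) (j : nat) :
  (n m)%:R / m%:R - ln m%:R @[m --> \oo] --> x ->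
  'C(m, j)%:R * (1 - j%:R / m%:R) ^+ n m @[m --> \oo] -->
    expR (- x) ^+ j / j`!%:R.
Proof.
set c := fun m => (n m)%:R / m%:R - ln m%:R => cx.
have hy : (j%:R * m%:R^-1 : R) @[m --> \oo] --> (j%:R * 0 : R).
  by apply: cvgM; [exact: cvg_cst|exact: cvg_invn].
have up : expR (- (j%:R * c m)) @[m --> \oo] --> expR (- x) ^+ j.
  rewrite -expRM_natl mulrN.
  apply: continuous_cvg; first exact: continuous_expR.
  by apply: cvgN; apply: cvgM => //; exact: cvg_cst.
(* The exponent j ln m - n(m) y/(1-y) of the lower bound, with y = j/m, rearranged so that every
   piece has a visible limit; the correction to -j c(m) vanishes because (ln m)/m does. *)
pose e m : R := - (j%:R * (c m + (c m * m%:R^-1 + ln m%:R * m%:R^-1)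
  * (j%:R * (1 - j%:R * m%:R^-1)^-1))).
have ex : e m @[m --> \oo] -->
    - (j%:R * (x + (x * 0 + 0) * (j%:R * (1 - j%:R * 0)^-1))).
  apply: cvgN; apply: cvgM; first exact: cvg_cst.
  apply: cvgD => //; apply: cvgM.
    apply: cvgD; last exact: cvg_lnn_div.
    by apply: cvgM => //; exact: cvg_invn.
  apply: cvgM; first exact: cvg_cst.
  apply: cvgV; first by rewrite mulr0 subr0 oner_eq0.
  by apply: cvgB => //; exact: cvg_cst.
rewrite mulr0 addr0 mul0r addr0 -mulrN in ex.
have low : expR (e m) @[m --> \oo] --> expR (- x) ^+ j.
  by rewrite -expRM_natl; exact: (continuous_cvg _ (@continuous_expR R _) ex).
have mid : m%:R ^+ j * (1 - j%:R / m%:R) ^+ n m @[m --> \oo] --> expR (- x) ^+ j.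
  apply: (squeeze_cvgr _ low up); near=> m.
  have jm : (j < m)%N by near: m; exact: nbhs_infty_gt.
  have m0 : 0 < m%:R :> R by rewrite ltr0n (leq_ltn_trans _ jm).
  have -> : m%:R ^+ j = expR (j%:R * ln m%:R) :> R.
    by rewrite expRM_natl lnK ?posrE.
  have j1 : j%:R / m%:R < 1 :> R by rewrite ltr_pdivrMr// mul1r ltr_nat.
  apply/andP; split.
    apply: (le_trans _ (ler_wpM2l (expR_ge0 _) (expr_1B_ge _ j1))).
    rewrite -expRD ler_expR /e /c le_eqVlt; apply/orP; left; apply/eqP; field.
    by rewrite gt_eqF//= subr_eq0 gt_eqF// ltr_nat.
  apply: le_trans (ler_wpM2l (expR_ge0 _) (expr_1B_le _ (ltW j1))) _.
  by rewrite -expRD ler_expR /c le_eqVlt; apply/orP; left; apply/eqP; field;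
    rewrite gt_eqF.
have : ((m ^_ j)%:R / m%:R ^+ j) * (m%:R ^+ j * (1 - j%:R / m%:R) ^+ n m) * j`!%:R^-1
    @[m --> \oo] --> 1 * (expR (- x) ^+ j) * j`!%:R^-1.
  apply: cvgM; last exact: cvg_cst.
  by apply: cvgM => //; exact: cvg_ffact.
rewrite mul1r; apply: cvg_trans; apply: near_eq_cvg.
near=> m.
have m0 : m%:R != 0 :> R.
  by rewrite pnatr_eq0 -lt0n; near: m; exact: nbhs_infty_gt.
rewrite -bin_ffact natrM; field.
by rewrite expf_neq0// pnatr_eq0 -lt0n fact_gt0.
Unshelve. all: by end_near. Qed.

End GumbelLimit.

(** * Gumbel limit for the proportion of surjections *)

Section SurjectionLimit.
Variable R : realType.

Lemma cvg_surjections_gumbel (n : nat -> nat) (x : R) :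
  (n m)%:R / m%:R - ln m%:R @[m --> \oo] --> x ->
  #|surjectiveb m (n m)|%:R / m%:R ^+ n m @[m --> \oo] --> gumbel_cdf x.
Proof.
set c := fun m => (n m)%:R / m%:R - ln m%:R => cx.
pose a m j : R := (-1) ^+ j * ('C(m, j)%:R * (1 - j%:R / m%:R) ^+ n m).
pose b j : R := (-1) ^+ j * (expR (- x) ^+ j / j`!%:R).
have bE : b = exp_coeff (- expR (- x)).
  by apply/funext => j; rewrite /b /exp_coeff/= (exprNn (expR _)) mulrA.
(* The [j]-th term is at most (e^{-c(m)})^j / j!, and e^{-c(m)} stays below e^{-x} + 1 for large
   [m]; the added 1 is the slack for this. *)
have h := @tannery R a b (exp_coeff (expR (- x) + 1)) (fun m => m.+1).
have -> : gumbel_cdf x = limn (series b) by rewrite bE.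
apply: cvg_trans (h _ _ _ _).
- apply: near_eq_cvg; near=> m.
  have m0 : m%:R != 0 :> R.
    by rewrite pnatr_eq0 -lt0n; near: m; exact: nbhs_infty_gt.
  rewrite card_surjections mulr_suml; apply: eq_bigr => j _; rewrite /a.
  have -> : 1 - j%:R / m%:R = (m - j)%:R / m%:R :> R.
    by rewrite natrB ?leq_ord// mulrBl divff.
  by rewrite expr_div_n !mulrA.
- move=> j; apply: cvgM; first exact: cvg_cst.
  exact: cvg_bin_gumbel.
- have cM : \forall m \near \oo, expR (- c m) < expR (- x) + 1.
    have ec : expR (- c m) @[m --> \oo] --> expR (- x).
      apply: (continuous_cvg _ (@continuous_expR R _)).
      exact: cvgN.
    by apply: (cvgr_lt (expR (- x)) ec); rewrite ltrDl.
  near=> m => j.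
  have m0 : 0 < m%:R :> R.
    by rewrite ltr0n; near: m; exact: nbhs_infty_gt.
  rewrite /a normrM normrX normrN1 expr1n mul1r /exp_coeff/=.
  have [mj|jm] := ltnP m j.
    by rewrite bin_small// mul0r normr0 divr_ge0// exprn_ge0// addr_ge0// expR_ge0.
  have j1 : j%:R / m%:R <= 1 :> R by rewrite ler_pdivrMr// mul1r ler_nat.
  have y0 : 0 <= (1 - j%:R / m%:R) ^+ n m :> R by rewrite exprn_ge0// subr_ge0.
  rewrite ger0_norm ?mulr_ge0//.
  apply: (@le_trans _ _ (m%:R ^+ j / j`!%:R * expR (- ((n m)%:R * (j%:R / m%:R))))).
    by apply: ler_pM => //; [exact: bin_le_expn_fact|exact: expr_1B_le].
  have -> : m%:R ^+ j / j`!%:R * expR (- ((n m)%:R * (j%:R / m%:R))) =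
      expR (- c m) ^+ j / j`!%:R :> R.
    rewrite mulrAC; congr (_ / _).
    rewrite -{1}(lnK m0) -!expRM_natl -expRD; congr expR; rewrite /c; field.
    by rewrite gt_eqF.
  rewrite ler_pM2r ?invr_gt0 ?ltr0n ?fact_gt0//.
  apply: lerXn2r; rewrite ?nnegrE ?expR_ge0 ?addr_ge0 ?expR_ge0// ltW//.
  by near: m.
- exact: is_cvg_series_exp_coeff.
- by move=> K; near=> m; rewrite ltnW// ltnS; near: m; exact: nbhs_infty_ge.
Unshelve. all: by end_near. Qed.

End SurjectionLimit.

(** * The collection time along a single sample path *)

Section Pathwise.
Variables (R : realType) (d : measure_display) (T : measurableType d)
  (C : nat -> T -> nat) (U : nat -> T -> R).
Variable m : nat.
Implicit Types (n i : nat) (t : T) (q : R).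

(** The index at which the supremum defining [last_draw] is attained, which allows reasoning in
    natural numbers. *)
Definition last_index i n t k :=
  [/\ (1 <= k <= n)%N, C k t = i & forall l, (k < l <= n)%N -> C l t <> i].

Definition all_seen n t :=
  forall i, (1 <= i <= m)%N -> exists2 k, (1 <= k <= n)%N & C k t = i.

Lemma ex_last_index i n t k :
  (1 <= k <= n)%N -> C k t = i -> exists k', last_index i n t k'.
Proof.
move=> kn Ck.
have ex : exists k, ((1 <= k <= n) && (C k t == i))%N.
  by exists k; rewrite kn Ck eqxx.
have ub l : ((1 <= l <= n) && (C l t == i) -> l <= n)%N by case/andP => /andP[].
case: (ex_maxnP ex ub) => k' /andP[k'n /eqP Ck'] mx; exists k'; split=> //.
move=> l /andP[kl ln] Cl; have := mx l; rewrite ln Cl eqxx (leq_trans _ kl)//.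
by move=> /(_ isT); rewrite leqNgt kl.
Qed.

Lemma last_drawE i n t k : last_index i n t k -> last_draw R C i n t = k%:R%:E.
Proof.
move=> [kn Ck lk]; apply/eqP; rewrite eq_le; apply/andP; split.
  apply: ub_ereal_sup => _ [l [ln Cl] <-]; rewrite lee_fin ler_nat leqNgt.
  by apply/negP => kl; apply: (lk l) => //; rewrite kl; case/andP: ln.
by apply: ereal_sup_ubound; exists k.
Qed.

Lemma last_draw_gt0 i n t :
  (0 < last_draw R C i n t)%E -> exists k, last_index i n t k.
Proof.
move=> /ereal_sup_gt[_ [k [kn Ck] _] _]; exact: ex_last_index Ck.
Qed.

(** Positivity excludes the supremum of the empty set, so a last draw exists, and [natrK] then
    recovers its index from the extended real. *)
Lemma clumsy_completeP q n t : clumsy_complete C U m q n t <->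
  forall i, (1 <= i <= m)%N -> exists2 k, last_index i n t k & U k t <= 1 - q.
Proof.
split=> h i im.
  have [/last_draw_gt0[k ki]] := h i im.
  by rewrite (last_drawE ki) /= natrK => Uk; exists k.
have [k ki Uk] := h i im; rewrite (last_drawE ki) /= natrK; split=> //.
by rewrite lte_fin ltr0n; case: ki => /andP[].
Qed.

Lemma clumsy_complete_all_seen q n t : clumsy_complete C U m q n t -> all_seen n t.
Proof. by move=> /clumsy_completeP h i /h[k [kn Ck _] _]; exists k. Qed.

Lemma all_seen_le n n' t : (n <= n')%N -> all_seen n t -> all_seen n' t.
Proof.
move=> nn' h i /h[k /andP[k0 kn] Ck]; exists k => //.
by rewrite k0 (leq_trans kn).
Qed.

(** The relation S = n for the first time S at which every coupon has been drawn; a relation,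
    because S need not exist on every path. *)
Definition first_seen n t :=
  [/\ (0 < n)%N, all_seen n t & forall k, (k < n)%N -> ~ all_seen k t].

Lemma first_seen_all_seen n k t : first_seen n t -> all_seen k t <-> (n <= k)%N.
Proof.
move=> [_ sn mn]; split=> [sk|nk]; last exact: all_seen_le nk sn.
by rewrite leqNgt; apply/negP => /mn.
Qed.

Lemma first_seen_uniq n n' t : first_seen n t -> first_seen n' t -> n = n'.
Proof.
move=> fn fn'; apply/eqP; rewrite eqn_leq.
apply/andP; split.
  by apply/(first_seen_all_seen _ fn); case: fn'.
by apply/(first_seen_all_seen _ fn'); case: fn.
Qed.

(* Where this holds, the clumsy time equals the first time all coupons are seen. *)
Definition unclumsy q t :=
  exists2 n, first_seen n t & clumsy_complete C U m q n t.

(** Completion at any time requires all coupons to have been seen, so S is always a lower bound; the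
    second hypothesis makes it attained. *)
Lemma clumsy_timeE q n t : first_seen n t -> clumsy_complete C U m q n t ->
  clumsy_time C U m q t = n%:R%:E.
Proof.
move=> fn cn; apply/eqP; rewrite eq_le; apply/andP; split.
  by apply: ereal_inf_lbound; exists n => //; split=> //; case: fn.
apply: le_ereal_inf_tmp => _ [k [k0 /clumsy_complete_all_seen ck] <-].
by rewrite lee_fin ler_nat; apply/(first_seen_all_seen _ fn).
Qed.

End Pathwise.

(** * Surjective words: their first covering prefix and their share among all words *)

Section FirstTime.
Variables (m N : nat).

(** S and the last draws before it, read off a finite word: [n] is the length of the shortest prefix
    containing every letter, and [l i] is the last position of [i] in it. Both depend on the word
    alone. *)
Lemma surjective_first_time (w : {ffun 'I_N -> 'I_m}) : w \in surjectiveb m N ->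
  exists n (l : 'I_m -> 'I_N), [/\ (n <= N)%N,
    forall k, (k < n)%N -> exists i, forall j : 'I_N, (j < k)%N -> w j != i,
    forall i, (l i < n)%N /\ w (l i) = i &
    forall i (j : 'I_N), (l i < j < n)%N -> w j != i].
Proof.
move=> /forallP sw.
pose Q n := [forall i, [exists k : 'I_N, (k < n)%N && (w k == i)]].
have exQ : exists n, Q n.
  exists N; apply/forallP => i; have /existsP[k wk] := sw i.
  by apply/existsP; exists k; rewrite ltn_ord.
case: (ex_minnP exQ) => n Qn mn.
have /boolp.choice[l lP] : forall i, exists l : 'I_N,
    [/\ (l < n)%N, w l = i & forall j : 'I_N, (l < j < n)%N -> w j != i].
  move=> i.
  move/forallP : Qn => /(_ i)/existsP[k0 k0P].
  case: (@arg_maxnP _ k0 (fun k : 'I_N => (k < n)%N && (w k == i)) (fun k => k) k0P).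
  move=> k /andP[kn /eqP wk] mk; exists k; split=> // j /andP[kj jn].
  apply/negP => wj; have := mk j; rewrite jn wj => /(_ isT).
  by rewrite /= leqNgt kj.
exists n, l; split.
- apply: mn; apply/forallP => i; have /existsP[k wk] := sw i.
  by apply/existsP; exists k; rewrite ltn_ord.
- move=> k kn; have : ~~ Q k by apply/negP => /mn; rewrite leqNgt kn.
  rewrite negb_forall => /existsP[i]; rewrite negb_exists => /forallP h.
  by exists i => j jk; have := h j; rewrite jk.
- by move=> i; have [] := lP i.
- by move=> i; have [] := lP i.
Qed.

(** In the inclusion-exclusion formula the term [j = 0] gives 1; each other term is a constant times
    the [n]-th power of a ratio in [0,1). *)
Lemma cvg_surjections1 (R : realType) : (0 < m)%N ->
  (#|surjectiveb m n|%:R / m%:R ^+ n : R) @[n --> \oo] --> (1 : R).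
Proof.
move=> m0; have mn0 : m%:R != 0 :> R by rewrite pnatr_eq0 -lt0n.
have E n : #|surjectiveb m n|%:R / m%:R ^+ n = 1 + \sum_(j < m)
    (-1) ^+ j.+1 * 'C(m, j.+1)%:R * ((m - j.+1)%:R / m%:R) ^+ n :> R.
  rewrite card_surjections mulr_suml big_ord_recl /=; congr (_ + _).
    by rewrite expr0 bin0 subn0 !mul1r divff// expf_neq0.
  by apply: eq_bigr => j _; rewrite expr_div_n !mulrA.
under eq_cvg do rewrite E.
suff h : \sum_(j < m) (-1) ^+ j.+1 * 'C(m, j.+1)%:R * ((m - j.+1)%:R / m%:R) ^+ n
    @[n --> \oo] --> (\sum_(j < m) (-1) ^+ j.+1 * 'C(m, j.+1)%:R * 0 : R).
  have := cvgD (cvg_cst (1 : R)) h.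
  have -> : \sum_(j < m) (-1) ^+ j.+1 * 'C(m, j.+1)%:R * 0 = 0 :> R.
    by rewrite big1// => j _; rewrite mulr0.
  rewrite addr0 => h1; exact: h1.
apply: cvg_big => [|j _]; first exact: add_continuous.
apply: cvgM; first exact: cvg_cst.
apply: cvg_expr; rewrite ger0_norm ?divr_ge0//.
by rewrite ltr_pdivrMr ?ltr0n// mul1r ltr_nat ltn_subrL.
Qed.

End FirstTime.

(** * Independence along duplicate-free lists, and the tail of the uniform law *)

Lemma mutually_independent_seq (R : realType) (d : measure_display)
    (T : measurableType d) (P : probability T R) (I : choiceType) (D : set I)
    (F : I -> set (set T)) (s : seq I) (A : I -> set T) :
  mutually_independent P D F -> uniq s ->
  (forall j, j \in s -> D j /\ F j (A j)) ->
  P [set t | forall j, j \in s -> A j t] = (\prod_(j <- s) P (A j))%E.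
Proof.
move=> ind us sDF; have := ind (seq_fset tt s) A.
rewrite (perm_big _ (seq_fset_perm _ _)) undup_id// => <-.
- congr (P _); apply/seteqP; split=> t h j.
    by move=> js; apply: h; rewrite -(seq_fsetE tt).
  by move=> js; apply: h => /=; rewrite (seq_fsetE tt s j).
- by move=> j js; apply: (sDF j _).1; rewrite -(seq_fsetE tt).
- by move=> j js; apply: (sDF j _).2; rewrite -(seq_fsetE tt).
Qed.

Lemma uniform_prob_gt (R : realType) (q : R) : 0 <= q <= 1 ->
  uniform_prob (@ltr01 R) `]1 - q, +oo[%classic = q%:E.
Proof.
move=> /andP[q0 q1]; rewrite /uniform_prob integral_uniform_pdf.
rewrite (_ : _ `&` _ = `]1 - q, 1]%classic); last first.
  apply/seteqP; split=> x /=; rewrite !in_itv/= andbT.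
    by move=> [-> /andP[]].
  move=> /andP[qx x1]; split=> //; rewrite x1 andbT ltW//.
  by apply: le_lt_trans qx; rewrite subr_ge0.
rewrite (eq_integral (fun=> 1%E)) => [|x]; last first.
  rewrite inE/= in_itv/= => /andP[qx x1]; rewrite /uniform_pdf x1 andbT ifT ?subr0 ?invr1//.
  by rewrite ltW// (le_lt_trans _ qx)// subr_ge0.
rewrite integral_cst// mul1e.
apply: eq_trans (lebesgue_measure_itv _) _; rewrite /= lte_fin.
case: ltP => [_|]; first by rewrite -EFinB opprB addrC subrK.
(* Here the interval is empty, and [1 <= 1 - q] together with [0 <= q] forces [q = 0]. *)
by move=> q1'; congr _%:E; lra.
Qed.

(** * The union bound and the law of a single draw *)

Section Probability.
Context (R : realType) (d : measure_display) (T : measurableType d).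
Variables (P : probability T R) (m : nat).
Variables (C : nat -> {RV P >-> nat}) (U : nat -> {RV P >-> R}).
Hypothesis m0 : (0 < m)%N.
Hypothesis CU : clumsy_coupons m C U.

Lemma probability_le_sum (I : finType) (A : set T) (F : I -> set T) :
  measurable A -> (forall i, measurable (F i)) ->
  (forall t, A t -> exists i, F i t) -> (P A <= \sum_i P (F i))%E.
Proof.
move=> mA mF AF.
suff h (r : seq I) B : measurable B ->
    (forall t, B t -> exists2 i, i \in r & F i t) -> (P B <= \sum_(i <- r) P (F i))%E.
  by rewrite h// => t /AF[i]; exists i => //; rewrite mem_index_enum.
elim: r B => [|i r IH] B mB BF.
  by rewrite big_nil (_ : B = set0) ?measure0//; apply/seteqP; split=> // t /BF[].
rewrite big_cons.
have mBF : measurable (B `\` F i) by exact: measurableD.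
apply: (@le_trans _ _ (P (F i `|` (B `\` F i)))).
  apply: le_measure; rewrite ?inE//; first exact: measurableU.
  by move=> t Bt; have [?|?] := pselect (F i t); [left|right].
apply: le_trans (measureU2 _ _ _) _ => //.
apply: leeD2l; apply: IH => // t [/BF[j]].
by rewrite inE => /orP[/eqP ->//|jr Fj _]; exists j.
Qed.

Lemma measurable_draw n (A : set nat) : measurable [set t | A (C n t)].
Proof. by rewrite -[X in measurable X]setTI; exact: measurable_funPT. Qed.

Lemma measurable_mark n (A : set R) : measurable A -> measurable [set t | A (U n t)].
Proof. by move=> mA; rewrite -[X in measurable X]setTI; exact: measurable_funPT. Qed.

(** The [m] prescribed masses 1/m already add up to 1, so no mass is left for other values. *)
Lemma draw_in_range n : (0 < n)%N -> P [set t | ~~ (1 <= C n t <= m)%N] = 0%E.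
Proof.
move=> n0; have [Cn _ _] := CU.
have -> : [set t | ~~ (1 <= C n t <= m)%N] = ~` [set t | (1 <= C n t <= m)%N].
  by apply/seteqP; split=> t /= /negP.
rewrite probability_setC; last exact: (measurable_draw n [set k | (1 <= k <= m)%N]).
suff -> : P [set t | (1 <= C n t <= m)%N] = 1%E by rewrite subee.
have -> : [set t | (1 <= C n t <= m)%N] =
    \big[setU/set0]_(i < m) [set t | C n t = i.+1].
  rewrite -(bigcup_mkord m (fun i => [set t | C n t = i.+1])).
  apply/seteqP; split=> t /=.
    by move=> /andP[c0 cm]; exists (C n t).-1; rewrite /= prednK.
  by move=> [i /= im ->].
rewrite measure_bigsetU_ord/=.
- rewrite (eq_bigr (fun=> (m%:R^-1)%:E)) => [|i _]; last by rewrite Cn//= ltn_ord.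
  by rewrite sumEFin sumr_const card_ord -(mulr_natr m%:R^-1) mulVf// pnatr_eq0 -lt0n.
- by move=> i; exact: (measurable_draw n [set k | k = i.+1]).
- by move=> i j _ _ [t [/= -> []]] /val_inj.
Qed.

(** * Probabilities of words of draws, with or without one mark *)

Section Words.
Variable N : nat.
Implicit Type w : {ffun 'I_N -> 'I_m}.

(* Ordinals are numbered from 0, draws and coupon labels from 1. *)
Definition word_event w := [set t | forall k : 'I_N, C k.+1 t = (w k).+1].

Lemma measurable_word_event w : measurable (word_event w).
Proof.
rewrite (_ : word_event w = \bigcap_(k in [set: 'I_N]) [set t | C k.+1 t = (w k).+1]).
  apply: fin_bigcap_measurable => [|k _]; first exact: finite_finset.
  exact: (measurable_draw _ [set c | c = (w k).+1]).
by apply/seteqP; split=> t /= h k; [move=> _; exact: h|exact: h].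
Qed.

Let draws : seq (nat + nat) := [seq inl k.+1 | k : 'I_N].

(** Quantifying over the positions [k] with [k.+1 = l] avoids inverting the shift between positions
    and draws; an [l] that matches no position gets no constraint. *)
Let draws_event w (B : nat -> set R) (j : nat + nat) : set T :=
  match j with
  | inl l => [set t | forall k : 'I_N, k.+1 = l -> C l t = (w k).+1]
  | inr l => [set t | B l (U l t)]
  end.

Let coupon_sigma_draws w B j : (forall l, measurable (B l)) ->
  coupon_sigma C U j (draws_event w B j).
Proof.
move=> mB; case: j => l /=.
  exists [set c | forall k : 'I_N, k.+1 = l -> c = (w k).+1] => //.
  by rewrite setTI.
by exists (B l) => //; rewrite setTI.
Qed.

Let prod_draws w B :
  (\prod_(j <- draws) P (draws_event w B j) = ((m%:R ^+ N)^-1)%:E)%E.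
Proof.
have [Cn _ _] := CU.
rewrite /draws big_image /=.
rewrite (eq_bigr (fun=> (m%:R^-1)%:E)) => [|k _]; last first.
  rewrite -(Cn k.+1 _ (w k).+1)//=.
  congr (P _); apply/seteqP; split=> t /=; first exact.
  by move=> Ct k' [/val_inj ->].
by rewrite prodEFin prodr_const card_ord exprVn.
Qed.

Let uniq_draws : uniq draws.
Proof. by rewrite map_inj_uniq ?enum_uniq// => i j [/val_inj]. Qed.

Lemma word_event_prob w : P (word_event w) = ((m%:R ^+ N)^-1)%:E.
Proof.
have [_ _ ind] := CU.
have mB (l : nat) : measurable (@setT R) by [].
pose A := draws_event w (fun=> setT).
rewrite -(prod_draws w (fun=> setT)) -(mutually_independent_seq (A := A) ind uniq_draws).
  congr (P _); apply/seteqP; split=> t h.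
    by move=> j /mapP[k _ ->] k' [/val_inj <-]; exact: h.
  by move=> k; apply: (h (inl k.+1)) => //; apply/mapP; exists k => //; rewrite mem_enum.
by move=> j jd; split; [case/mapP: jd => k _ ->|exact: coupon_sigma_draws].
Qed.

(** Adding one mark to the list of draws multiplies the product by [q]. Since [k] is arbitrary it
    may be chosen as a function of [w], which replaces conditioning on the draws. *)
Lemma word_event_mark_prob w (k : 'I_N) (q : R) : 0 <= q <= 1 ->
  P (word_event w `&` [set t | 1 - q < U k.+1 t]) = ((m%:R ^+ N)^-1 * q)%:E.
Proof.
move=> /andP[q0 q1]; have [_ Un ind] := CU.
pose B (l : nat) : set R := `]1 - q, +oo[%classic.
have mB l : measurable (B l) by exact: measurable_itv.
pose A := draws_event w B.
have PU : P (A (inr k.+1)) = q%:E.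
  have := Un k.+1 isT (B k.+1) (mB _); rewrite /distribution /pushforward /= => ->.
  by apply: uniform_prob_gt; rewrite q0 q1.
have us : uniq (inr k.+1 :: draws).
  by rewrite /= uniq_draws andbT; apply/negP => /mapP[].
have := mutually_independent_seq (A := A) ind us.
rewrite big_cons prod_draws PU -EFinM mulrC => <-.
- congr (P _); apply/seteqP; split=> t.
    move=> [h Ut] j; rewrite inE => /orP[/eqP ->|].
      by rewrite /A/= /B/= in_itv/= Ut.
    by move=> /mapP[k' _ ->] k'' [/val_inj <-]; exact: h.
  move=> h; split.
    move=> k'; apply: (h (inl k'.+1)) => //.
    by rewrite inE; apply/orP; right; apply/mapP; exists k' => //; rewrite mem_enum.
  have := h (inr k.+1); rewrite mem_head => /(_ isT).
  by rewrite /A/= /B/= in_itv/= andbT.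
- move=> j; rewrite inE => jd; split; last exact: coupon_sigma_draws.
  by case/orP: jd => [/eqP ->//|/mapP[k' _ ->]].
Qed.

End Words.

(** * Completion events, decomposed according to the word drawn *)

Local Notation seen_event n := [set t | all_seen C m n t].
Local Notation complete_event q n := [set t | clumsy_complete C U m q n t].
Local Notation unclumsy_event q := [set t | unclumsy C U m q t].

Let mm0 : m%:R != 0 :> R. Proof. by rewrite pnatr_eq0 -lt0n. Qed.

(** The word events cover every sample point whose first [N] draws lie in range, hence all but a
    null event; the rest is the union bound. *)
Lemma probability_le_words N (E : set T) (c : {ffun 'I_N -> 'I_m} -> \bar R) :
  measurable E -> (forall w, (P (E `&` word_event w) <= c w)%E) ->
  (P E <= \sum_w c w)%E.
Proof.
move=> mE Ec.
pose out := [set t | exists k : 'I_N, ~~ (1 <= C k.+1 t <= m)%N].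
have mo : measurable out.
  rewrite (_ : out = \bigcup_(k in [set: 'I_N]) [set t | ~~ (1 <= C k.+1 t <= m)%N]).
    apply: fin_bigcup_measurable => [|k _]; first exact: finite_finset.
    exact: (measurable_draw _ [set c | ~~ (1 <= c <= m)%N]).
  by apply/seteqP; split=> t [k]; [exists k|exists k].
have out0 : P out = 0%E.
  apply/eqP; rewrite eq_le measure_ge0 andbT.
  apply: (@le_trans _ _ (\sum_(k < N) P [set t | ~~ (1 <= C k.+1 t <= m)%N])%E).
    apply: (probability_le_sum (F := fun k : 'I_N => [set t | ~~ (1 <= C k.+1 t <= m)%N])) => //.
    move=> k; exact: (measurable_draw _ [set c | ~~ (1 <= c <= m)%N]).
  by rewrite big1// => k _; exact: draw_in_range.
apply: (@le_trans _ _ (P out + P (E `\` out))%E).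
  have mEo : measurable (E `\` out) by exact: measurableD.
  apply: le_trans (measureU2 _ _ _) => //.
  apply: le_measure; rewrite ?inE//; first exact: measurableU.
  by move=> t Et; have [?|?] := pselect (out t); [left|right].
rewrite out0 add0e.
apply: (@le_trans _ _ (\sum_w P (E `&` word_event w))%E); last exact: lee_sum.
apply: probability_le_sum.
- exact: measurableD.
- by move=> w; apply: measurableI => //; exact: measurable_word_event.
move=> t [Et /= nout].
have inr (k : 'I_N) : (1 <= C k.+1 t <= m)%N.
  by apply: contrapT => /negP h; apply: nout; exists k.
have lt (k : 'I_N) : ((C k.+1 t).-1 < m)%N by have /andP[] := inr k; case: (C k.+1 t).
exists [ffun k => Ordinal (lt k)]; split=> // k.
by rewrite ffunE /= prednK//; have /andP[] := inr k.
Qed.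

Lemma word_all_seen N w t : word_event w t ->
  seen_event N t <-> w \in surjectiveb m N.
Proof.
move=> wt; split=> [h|/forallP h].
  apply/forallP => i; have [k /andP[k0 kN] Ck] := h i.+1 (ltn_ord i).
  have k1 : (k.-1 < N)%N by rewrite prednK.
  apply/existsP; exists (Ordinal k1); apply/eqP/val_inj => /=.
  by have := wt (Ordinal k1); rewrite /= prednK// Ck => -[].
move=> i /andP[i0 im]; have i1 : (i.-1 < m)%N by rewrite prednK.
have /existsP[k /eqP wk] := h (Ordinal i1).
by exists k.+1; [exact: ltn_ord|rewrite wt wk /= prednK].
Qed.

Lemma measurable_all_seen n : measurable (seen_event n).
Proof.
rewrite (_ : [set t | _] = \bigcap_(i in [set i | (1 <= i <= m)%N])
  \bigcup_(k in [set k | (1 <= k <= n)%N]) [set t | C k t = i]).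
  apply: bigcap_measurable => [|i _]; first by exists 1%N.
  apply: bigcup_measurable => k _.
  exact: (measurable_draw _ [set c | c = i]).
by apply/seteqP; split=> t h i /h[k]; exists k.
Qed.

Lemma measurable_complete q n : measurable (complete_event q n).
Proof.
rewrite (_ : [set t | _] = \bigcap_(i in [set i | (1 <= i <= m)%N])
  \bigcup_(k in [set k | (1 <= k <= n)%N]) ([set t | C k t = i] `&`
    \bigcap_(l in [set l | (k < l <= n)%N]) [set t | C l t <> i] `&`
    [set t | U k t <= 1 - q])).
  apply: bigcap_measurable => [|i _]; first by exists 1%N.
  apply: bigcup_measurable => k _.
  apply: measurableI; last first.
    have := measurable_mark k (measurable_itv `]-oo, (1 - q)]).
    by congr measurable; apply/seteqP; split=> t /=; rewrite in_itv/=.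
  apply: measurableI; first exact: (measurable_draw _ [set c | c = i]).
  (* When [n <= k] there is no later draw to constrain, and the empty intersection is the whole
     space. *)
  have [->|/set0P[l0 kl0]] := eqVneq [set l | (k < l <= n)%N] set0.
    by rewrite bigcap_set0.
  apply: bigcap_measurable => [|l _]; first by exists l0.
  exact: (measurable_draw _ [set c | c <> i]).
apply/seteqP; split=> t.
  move=> /clumsy_completeP h i /h[k [kn Ck lk] Uk].
  by exists k => //; split.
move=> h; apply/clumsy_completeP => i /h[k kn [[Ck lk] Uk]].
by exists k.
Qed.

Lemma probability_all_seen n :
  P (seen_event n) = (#|surjectiveb m n|%:R / m%:R ^+ n)%:E.
Proof.
pose Q : pred {ffun 'I_n -> 'I_m} := surjectiveb m n.
(* Every word has mass m^{-n}, so an event whose words all satisfy [Q'] has at most the total mass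
   of those words. *)
have h (E : set T) (Q' : pred {ffun 'I_n -> 'I_m}) : measurable E ->
    (forall t w, word_event w t -> E t -> Q' w) ->
    (P E <= (#|Q'|%:R / m%:R ^+ n)%:E)%E.
  move=> mE EQ.
  have -> : (#|Q'|%:R / m%:R ^+ n)%:E =
      \sum_w (if Q' w then ((m%:R ^+ n)^-1)%:E else 0)%E :> \bar R.
    rewrite -big_mkcond sumEFin sumr_const; congr _%:E.
    by rewrite -(mulr_natl (m%:R ^+ n)^-1).
  apply: probability_le_words => // w; case: ifPn => Qw.
    rewrite -(word_event_prob w); apply: le_measure.
    - by rewrite inE; apply: measurableI => //; exact: measurable_word_event.
    - by rewrite inE; exact: measurable_word_event.
    - by move=> t [].
  rewrite (_ : _ `&` _ = set0) ?measure0//.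
  apply/seteqP; split=> // t [Et wt].
  by move/negP : Qw; apply; exact: EQ wt Et.
(* Subadditivity over words bounds the event and its complement from above, and
   the two bounds add up to 1. *)
apply/eqP; rewrite eq_le; apply/andP; split.
  by apply: h => [|t w wt /(word_all_seen wt)//]; exact: measurable_all_seen.
have /h : measurable (~` seen_event n) by apply: measurableC; exact: measurable_all_seen.
move=> /(_ (predC Q)).
rewrite probability_setC; last exact: measurable_all_seen.
have -> : #|predC Q|%:R / m%:R ^+ n = 1 - #|Q|%:R / m%:R ^+ n :> R.
  apply/eqP; rewrite eq_sym subr_eq -mulrDl -natrD addnC cardC.
  by rewrite card_ffun !card_ord natrX divff// expf_neq0.
have := fin_num_measure P _ (measurable_all_seen n).
move=> /fineK <-; rewrite -EFinB lee_fin lerD2l lerN2 -lee_fin; apply.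
move=> t w wt nt; apply/negP => Qw; apply: nt.
exact/(word_all_seen wt).
Qed.

Lemma measurable_unclumsy q : measurable (unclumsy_event q).
Proof.
rewrite (_ : [set t | _] = \bigcup_(n in [set n | (0 < n)%N])
  (seen_event n `&` complete_event q n `\` \bigcup_(k in [set k | (k < n)%N]) seen_event k)).
  apply: bigcup_measurable => n _; apply: measurableD.
    by apply: measurableI; [exact: measurable_all_seen|exact: measurable_complete].
  by apply: bigcup_measurable => k _; exact: measurable_all_seen.
apply/seteqP; split=> t.
  move=> [n [n0 sn mn] cn]; exists n => //; split=> // -[k kn]; exact: mn.
move=> [n n0 [[sn cn] mn]]; exists n => //; split=> // k kn sk.
by apply: mn; exists k.
Qed.

Lemma probability_clumsy q : 0 <= q <= 1 ->
  (P (~` unclumsy_event q) <= (m%:R * q)%:E)%E.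
Proof.
move=> q01; set E := ~` unclumsy_event q.
have mE : measurable E by apply: measurableC; exact: measurable_unclumsy.
(* The words of length N that miss a coupon are negligible as N grows. *)
have h N : (P E <= (m%:R * q + (1 - #|surjectiveb m N|%:R / m%:R ^+ N))%:E)%E.
  (* The allowance for one word: [m] marks, each failing with probability [q], plus the full mass of
     the word when it misses a coupon. *)
  pose c (w : {ffun 'I_N -> 'I_m}) : R := m%:R * ((m%:R ^+ N)^-1 * q) +
    (if predC (surjectiveb m N) w then (m%:R ^+ N)^-1 else 0).
  have -> : m%:R * q + (1 - #|surjectiveb m N|%:R / m%:R ^+ N) = \sum_w c w.
    rewrite big_split /= sumr_const card_ffun !card_ord -big_mkcond sumr_const /=.
    congr (_ + _).
      rewrite -[RHS]mulr_natl natrX mulrCA; congr (_ * _).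
      by rewrite mulrA mulfV ?mul1r// expf_neq0.
    rewrite -[RHS]mulr_natl.
    have -> : #|predC (surjectiveb m N)|%:R = m%:R ^+ N - #|surjectiveb m N|%:R :> R.
      apply/eqP; rewrite eq_sym subr_eq -natrX -natrD eqr_nat addnC cardC.
      by rewrite card_ffun !card_ord.
    by field; rewrite expf_neq0.
  rewrite -sumEFin; apply: probability_le_words => // w.
  rewrite /c; case: ifPn => [_|/negPn sw].
    apply: (@le_trans _ _ (P (word_event w))).
      apply: le_measure.
      - by rewrite inE; apply: measurableI => //; exact: measurable_word_event.
      - by rewrite inE; exact: measurable_word_event.
      - by move=> t [].
    rewrite word_event_prob lee_fin lerDr.
    by case/andP: q01 => q0 _; rewrite !mulr_ge0// invr_ge0 exprn_ge0.
  have [n [l [nN mn ln lastl]]] := surjective_first_time sw.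
  rewrite addr0.
  (* Once [w] is fixed so is [l i], hence each [F i] concerns a mark of deterministic index. *)
  pose F i := word_event w `&` [set t | 1 - q < U (l i).+1 t].
  apply: (@le_trans _ _ (\sum_i P (F i))%E).
    apply: probability_le_sum.
    - by apply: measurableI => //; exact: measurable_word_event.
    - move=> i; apply: measurableI; first exact: measurable_word_event.
      have := measurable_mark (l i).+1 (measurable_itv `]1 - q, +oo[).
      by congr measurable; apply/seteqP; split=> t /=; rewrite in_itv/= andbT.
    (* If no [F i] occurs, then [n] is the first time all coupons are seen and the last draws
       [(l i).+1] all have good marks, contradicting [Et]. Position [k] of the word is draw [k.+1],
       whence the shifts below. *)
    move=> t [Et wt]; apply: contrapT => nF; apply: Et.
    have ln0 i : (0 < i <= m)%N -> exists i' : 'I_m, i = i'.+1.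
      move=> /andP[i0 im]; have i1 : (i.-1 < m)%N by rewrite prednK.
      by exists (Ordinal i1); rewrite /= prednK.
    exists n.
      split.
      - by have [+ _] := ln (Ordinal m0); exact: leq_ltn_trans.
      - move=> i /ln0[i' ->]; have [li wi] := ln i'.
        by exists (l i').+1; [rewrite li|rewrite wt wi].
      - move=> k kn sk; have [i ni] := mn k kn.
        have [k' /andP[k'0 k'k] Ck'] := sk i.+1 (ltn_ord i).
        have k'N : (k'.-1 < N)%N by rewrite prednK// (leq_trans k'k)// (leq_trans (ltnW kn)).
        have := ni (Ordinal k'N); rewrite /= prednK// => /(_ k'k) /eqP; apply.
        by apply: val_inj; have := wt (Ordinal k'N); rewrite /= prednK// Ck' => -[].
    apply/clumsy_completeP => i /ln0[i' ->]; have [li wi] := ln i'.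
    exists (l i').+1.
      split; [by rewrite li|by rewrite wt wi|move=> k /andP[lk kn] Ck].
      have k0 : (0 < k)%N by exact: leq_ltn_trans lk.
      have kN : (k.-1 < N)%N by rewrite prednK// (leq_trans kn).
      have := lastl i' (Ordinal kN); rewrite /= prednK// kn andbT -ltnS prednK// => /(_ lk)/eqP; apply.
      by apply: val_inj; have := wt (Ordinal kN); rewrite /= prednK// Ck => -[].
    by rewrite leNgt; apply/negP => Ul; apply: nF; exists i'.
  rewrite (eq_bigr (fun=> ((m%:R ^+ N)^-1 * q)%:E)) => [|i _]; last first.
    exact: word_event_mark_prob.
  by rewrite sumEFin sumr_const card_ord mulr_natl.
(* Let [N] tend to infinity in [h]: the proportion of surjective words tends to 1, which removes the
   second term. *)
have -> : (m%:R * q)%:E = (m%:R * q + (1 - 1))%:E by rewrite subrr addr0.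
have cN : (fun N => (m%:R * q + (1 - #|surjectiveb m N|%:R / m%:R ^+ N))%:E)
    @ \oo --> (m%:R * q + (1 - 1))%:E.
  apply: cvg_EFin; first by near=> N.
  apply: cvgD; first exact: cvg_cst.
  apply: cvgB; first exact: cvg_cst.
  exact: cvg_surjections1.
by apply: (lee_cvg_to (cvg_cst (P E)) cN); near=> N; exact: h.
Unshelve. all: by end_near. Qed.

(** * Comparison and distribution of the collection times *)

Local Notation time q := (clumsy_time C U m q).

Lemma measurable_clumsy_time q : measurable_fun setT (time q).
Proof.
(* Giving inadmissible times the value [+oo], neutral for infima, turns an infimum over a
   path-dependent set into that of a fixed sequence of measurable functions. *)
pose u n t : \bar R := if (0 < n)%N && `[< complete_event q n t >] then n%:R%:E else +oo%E.
have -> : time q = (fun t => einfs (u ^~ t) 0).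
  apply/funext => t; apply/eqP; rewrite eq_le; apply/andP; split.
    apply: le_ereal_inf_tmp => _ [n _ <-]; rewrite /u.
    case: ifPn => [/andP[n0 /asboolP cn]|_]; last by rewrite leey.
    by apply: ereal_inf_lbound; exists n.
  apply: le_ereal_inf_tmp => _ [n [n0 cn] <-].
  apply: ereal_inf_lbound; exists n => //=; rewrite /u n0 /= ifT//.
  exact/asboolP.
apply: measurable_fun_einfs => n; apply: measurable_fun_ifT => //.
apply: (measurable_fun_bool true); rewrite setTI.
case: (posnP n) => [->|n0].
  by rewrite (_ : _ @^-1` _ = set0)//; apply/seteqP; split.
rewrite (_ : _ @^-1` _ = complete_event q n); first exact: measurable_complete.
by apply/seteqP; split=> t /=; [move=> /asboolP|move=> ?; apply/asboolP].
Qed.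

(** Outside the failure events for [q] and for 0 both times equal S. The failure event for 0 is
    null, being bounded by [m] times 0. *)
Lemma clumsy_time_diff q e : 0 <= q <= 1 -> 0 < e ->
  (P [set t | (e%:E < `|(time q t - time 0%R t) * (m%:R^-1)%:E - 0%:E|)%E]
    <= (m%:R * q)%:E)%E.
Proof.
move=> q01 e0; set E := [set t | _].
have mE : measurable E.
  rewrite -[E]setTI; apply: emeasurable_fun_o_infty => //.
  apply: measurableT_comp => //.
  apply: emeasurable_funB => //; apply: emeasurable_funM => //.
  by apply: emeasurable_funB; exact: measurable_clumsy_time.
have mq r : measurable (~` unclumsy_event r).
  by apply: measurableC; exact: measurable_unclumsy.
have EU : E `<=` ~` unclumsy_event q `|` ~` unclumsy_event 0.
  move=> t Et; apply: contrapT => /not_orP[/contrapT[n fn cn] /contrapT[n' fn' cn']].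
  have nn' := first_seen_uniq fn fn'; subst n'.
  move: Et; rewrite /E /= (clumsy_timeE fn cn).
  rewrite (clumsy_timeE fn' cn').
  by rewrite -EFinB subrr mul0r subr0 abse0 lte_fin ltNge ltW.
apply: (@le_trans _ _ (P (~` unclumsy_event q) + P (~` unclumsy_event 0))%E).
  apply: (@le_trans _ _ (P (~` unclumsy_event q `|` ~` unclumsy_event 0))); last first.
    by apply: measureU2; exact: mq.
  by apply: le_measure EU; rewrite inE//; apply: measurableU; exact: mq.
rewrite -[leRHS]adde0; apply: leeD; first exact: probability_clumsy.
rewrite (le_trans (probability_clumsy _))//.
  by rewrite lexx ler01.
Qed.

(** Outside the failure event the time is the integer S, so comparing it with a nonnegative real
    threshold is comparing it with the floor [n], and S <= n says that all coupons are seen by time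
    [n]. The failure event costs at most [m * q] on either side. *)
Lemma clumsy_time_cdf q x : 0 <= q <= 1 -> 0 <= m%:R * ln m%:R + m%:R * x ->
  let n := Num.truncn (m%:R * ln m%:R + m%:R * x) in
  let F := [set t | ((time q t - (m%:R * ln m%:R)%:E) * (m%:R^-1)%:E <= x%:E)%E] in
  ((#|surjectiveb m n|%:R / m%:R ^+ n - m%:R * q)%:E <= P F)%E /\
  (P F <= (#|surjectiveb m n|%:R / m%:R ^+ n + m%:R * q)%:E)%E.
Proof.
move=> q01 r0 n F.
have mq : measurable (~` unclumsy_event q).
  by apply: measurableC; exact: measurable_unclumsy.
have mS := measurable_all_seen n.
have mF : measurable F.
  rewrite -[F]setTI; apply: emeasurable_fun_infty_c => //.
  apply: emeasurable_funM => //.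
  by apply: emeasurable_funB => //; exact: measurable_clumsy_time.
have FE t : unclumsy_event q t -> F t <-> seen_event n t.
  move=> [k fk ck]; rewrite /F /= (clumsy_timeE fk ck).
  rewrite -EFinB -EFinM lee_fin ler_pdivrMr ?ltr0n// lerBlDl (mulrC x).
  by rewrite -truncn_ge_nat//; apply: iff_sym; exact: first_seen_all_seen.
have h A B : measurable A -> measurable B -> A `<=` B `|` ~` unclumsy_event q ->
    (P A <= P B + (m%:R * q)%:E)%E.
  move=> mA mB AB; apply: (@le_trans _ _ (P B + P (~` unclumsy_event q))%E).
    apply: (@le_trans _ _ (P (B `|` ~` unclumsy_event q))); last first.
      by apply: measureU2 => //; exact: mq.
    by apply: le_measure AB; rewrite inE//; apply: measurableU => //; exact: mq.
  by apply: leeD2l; exact: probability_clumsy.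
rewrite EFinB EFinD -probability_all_seen; split.
  rewrite leeBlDr//; apply: h => // t St.
  by have [Gt|] := pselect (unclumsy_event q t); [left; exact/FE|right].
apply: h => // t Ft.
by have [Gt|] := pselect (unclumsy_event q t); [left; exact/FE|right].
Qed.

End Probability.

(** * Passage to the limit in the number of coupons *)

Lemma near_shifted_mul_ln_ge0 (R : realType) (x : R) :
  \forall m \near \oo, 0 <= m%:R * ln m%:R + m%:R * x.
Proof.
near=> m; rewrite -mulrDr mulr_ge0// -[x]opprK subr_ge0.
have : expR (- x) <= m%:R by near: m; exact: nbhs_infty_ger.
rewrite -{2}(expRK (- x)) => xm; rewrite ler_ln ?posrE ?expR_gt0//.
exact: lt_le_trans (expR_gt0 _) xm.
Unshelve. all: by end_near. Qed.

(** Truncation moves the threshold by less than 1, hence the quotient by less than 1/m. *)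
Lemma cvg_truncn_gumbel (R : realType) (x : R) :
  (Num.truncn (m%:R * ln m%:R + m%:R * x))%:R / m%:R - ln m%:R @[m --> \oo] --> x.
Proof.
have h : (x - m%:R^-1 : R) @[m --> \oo] --> x - 0.
  by apply: cvgB; [exact: cvg_cst|exact: cvg_invn].
rewrite subr0 in h; apply: (squeeze_cvgr _ h (cvg_cst x)).
near=> m; have m0 : 0 < m%:R :> R.
  by rewrite ltr0n; near: m; exact: nbhs_infty_gt.
have r0 : 0 <= m%:R * ln m%:R + m%:R * x by near: m; exact: near_shifted_mul_ln_ge0.
have /andP[n1 n2] := truncn_itv r0.
apply/andP; split.
  have -> : x - m%:R^-1 = (m%:R * ln m%:R + m%:R * x - 1) / m%:R - ln m%:R.
    by field; rewrite gt_eqF.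
  by rewrite lerD2r ler_pM2r ?invr_gt0// lerBlDr natr1 ltW.
have {2}-> : x = (m%:R * ln m%:R + m%:R * x) / m%:R - ln m%:R.
  by field; rewrite gt_eqF.
by rewrite lerD2r ler_pM2r ?invr_gt0.
Unshelve. all: by end_near. Qed.

Theorem theorem4p6 (R : realType) (d : nat -> measure_display)
    (T : forall m, measurableType (d m)) (P : forall m, probability (T m) R)
    (C : forall m, nat -> {RV (P m) >-> nat})
    (U : forall m, nat -> {RV (P m) >-> R})
    (p : nat -> R^o) :
  (forall m, (0 < m)%N -> clumsy_coupons m (C m) (U m)) ->
  (forall m, (0 < m)%N -> 0 <= p m < 1) ->
  p =o_\oo (fun m => m%:R^-1 : R^o) ->
  let time (m : nat) (q : R) : T m -> \bar R :=
    clumsy_time (fun n => C m n) (fun n => U m n) m q in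
  cvg_in_probability P
    (fun m w => ((time m (p m) w - time m 0%R w) * (m%:R^-1)%:E)%E) 0 /\
  cvg_in_law P
    (fun m w => ((time m (p m) w - (m%:R * ln m%:R)%:E) * (m%:R^-1)%:E)%E)
    (@gumbel_cdf R).
Proof.
move=> CU p01 /eqoP po time.
have p01' m : (0 < m)%N -> 0 <= p m <= 1.
  by move=> /p01/andP[-> /ltW].
(* This is the assumption p = o(1/m) multiplied by [m], and bounds all failure probabilities. *)
have mp : (m%:R * p m : R) @[m --> \oo] --> (0 : R).
  apply/cvgrPdist_le => e e0; rewrite /=.
  near=> m; have m0 : (0 < m)%N by near: m; exact: nbhs_infty_gt.
  have : `|p m| <= e * `|m%:R^-1| by near: m; exact: po.
  rewrite sub0r normrN normrM normfV ler_pdivlMr ?normr_gt0 ?pnatr_eq0 -?lt0n//.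
  by rewrite mulrC.
have emp : (m%:R * p m)%:E @[m --> \oo] --> (0 : \bar R).
  by apply: cvg_EFin => //; near=> m.
split.
  move=> e e0; apply: (squeeze_cvge _ (cvg_cst 0%E) emp).
  near=> m; have m0 : (0 < m)%N by near: m; exact: nbhs_infty_gt.
  rewrite measure_ge0/=; apply: clumsy_time_diff => //; first exact: CU.
  exact: p01'.
(* The limit law comes from squeezing the distribution function between two sequences that differ
   from the surjection proportion by [m * p m], without passing through convergence in
   probability. *)
move=> x _.
pose n m := Num.truncn (m%:R * ln m%:R + m%:R * x).
have sg := cvg_surjections_gumbel (@cvg_truncn_gumbel R x).
have lo : (#|surjectiveb m (n m)|%:R / m%:R ^+ n m - m%:R * p m)%:E @[m --> \oo]
    --> (gumbel_cdf x)%:E.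
  apply: cvg_EFin; first by near=> m.
  by rewrite -[X in _ --> X]subr0; apply: cvgB.
have hi : (#|surjectiveb m (n m)|%:R / m%:R ^+ n m + m%:R * p m)%:E @[m --> \oo]
    --> (gumbel_cdf x)%:E.
  apply: cvg_EFin; first by near=> m.
  by rewrite -[X in _ --> X]addr0; apply: cvgD.
apply: (squeeze_cvge _ lo hi).
near=> m; have m0 : (0 < m)%N by near: m; exact: nbhs_infty_gt.
apply/andP; apply: clumsy_time_cdf => //; [exact: CU|exact: p01'|].
by near: m; exact: near_shifted_mul_ln_ge0.
Unshelve. all: by end_near. Qed.
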